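(* Let $k\ge 3$ be odd and let $G$ be an odd unicycle graph of girth $k$ whose unique cycle has vertices $u,u_1,\dots,u_{k-1}$ with $\deg u=4$ and $\deg u_i=2$ for $1\le i\le k-1$. Let $v_1$ and $w_1$ be the two neighbours of $u$ not on the cycle. If the Grover walk on $G$ is periodic, then either $\deg v_1=\deg w_1=1$ or $\deg v_1=\deg w_1=2$.
   Context: Graphs are simple, connected and finite. An odd unicycle graph is a non-bipartite graph with $|V|=|E|$, i.e. a connected graph with exactly one cycle, of odd length (its girth). For $G=(V,E)$, let $\mathcal{A}=\{(a,b),(b,a)\mid ab\in E\}$; for an arc $e=(a,b)$ write $o(e)=a$, $t(e)=b$, $\bar e=(b,a)$. The Grover walk has time evolution $U$ on $\mathbb{C}^{\mathcal{A}}$ with $U_{e,f}=2/\deg t(f)$ if $t(f)=o(e)$, $e\neq\bar f$; $U_{e,f}=2/\deg t(f)-1$ if $e=\bar f$; $0$ otherwise. The walk is periodic if $U^m=I$ for some positive integer $m$. *)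

(* Defs.v *)
From HB Require Import structures.
From mathcomp Require Import all_boot all_order all_algebra.
Set Implicit Arguments. Unset Strict Implicit. Unset Printing Implicit Defensive.
Import Order.TTheory GRing.Theory Num.Theory.

Section Graph.
Variables (T : finType) (e : rel T).

Definition simple_graph : Prop := symmetric e /\ irreflexive e.
Definition connected_graph : Prop := forall x y : T, connect e x y.
Definition edges : {set {set T}} :=
  [set [set p.1; p.2] | p in [pred p : T * T | e p.1 p.2]].
Definition bipartite : Prop :=
  exists f : T -> bool, forall x y, e x y -> f x != f y.
Definition odd_unicycle : Prop :=
  [/\ simple_graph, connected_graph, ~ bipartite & #|edges| = #|T|].

Definition deg (x : T) : nat := #|[set y | e x y]|.

Definition arc := {p : T * T | e p.1 p.2}.
Definition org (a : arc) : T := (val a).1.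
Definition term (a : arc) : T := (val a).2.

Local Open Scope ring_scope.
Definition grover_entry (a b : arc) : rat :=
  if (org a == term b) && (org b == term a) then 2 / (deg (term b))%:R - 1
  else if term b == org a then 2 / (deg (term b))%:R
  else 0.

Definition grover_matrix : 'M[rat]_#|{: arc}| :=
  \matrix_(i, j) grover_entry (enum_val i) (enum_val j).

Definition grover_periodic : Prop :=
  exists m : nat, (0 < m)%N /\ grover_matrix ^+ m = 1%:M.
End Graph.

(* Main.v *)
Require Import Defs.
From HB Require Import structures.
From mathcomp Require Import all_boot all_order all_algebra.
From mathcomp Require Import all_field ring zify.
Set Implicit Arguments. Unset Strict Implicit. Unset Printing Implicit Defensive.
Import Order.TTheory GRing.Theory Num.Theory.

(** Let N be twice the transition matrix of the random walk. Eigenvectors of N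
    with eigenvalue x + 1/x lift to eigenvectors of U with eigenvalue x or 1/x,
    so if the walk is periodic then the eigenvalues of N are algebraic integers
    and the characteristic polynomial phi of N is integral.

    Let P and P' be the characteristic polynomials of the blocks of N on the
    paths u_1, ..., u_(k-1) and u_1, ..., u_(k-2), and R that of the block on
    the forest F left when the cycle is removed. A Schur complement at u gives
      phi = (X P - P' - 1) R - P Q,
    where Q comes from the resolvent of F at v_1 and w_1, and has degree |F| - 1
    and leading coefficient 1/deg v_1 + 1/deg w_1. Since F + u is bipartite, the
    part of phi whose exponents have the parity of |F| is -R, so R is integral.
    Then P Q is integral, and P is monic, so 1/deg v_1 + 1/deg w_1 is an
    integer, which leaves only (1, 1) and (2, 2). *)

(** * Bordered determinants and resolvents with polynomial entries *)

Section PolyMatrices.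
Local Open Scope ring_scope.

Lemma adj_unique (D : idomainType) n (A X : 'M[D]_n) :
  \det A != 0 -> A *m X = (\det A)%:M -> X = \adj A.
Proof.
move=> dA_neq0 AX.
have: (\det A) *: X = (\det A) *: \adj A.
  by rewrite -mul_scalar_mx -mul_adj_mx -mulmxA AX mul_mx_scalar.
move/matrixP=> E; apply/matrixP=> i j; have := E i j; rewrite !mxE.
exact: mulfI.
Qed.

(** Schur complement without inverting [A]: a factor of determinant [\det A] clears the lower left
    block, and [\det A] is cancelled at the end. *)
Lemma det_bordered (D : idomainType) n (a : D) (b : 'rV_n) (c : 'cV_n)
    (A : 'M[D]_n) :
  \det A != 0 ->
  \det (block_mx a%:M b c A) = a * \det A - (b *m \adj A *m c) 0 0.
Proof.
move=> dA_neq0; apply: (mulIf dA_neq0).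
have -> : \det (block_mx a%:M b c A) * \det A =
    \det (block_mx a%:M b c A *m block_mx (\det A)%:M 0 (- (\adj A *m c)) 1%:M).
  by rewrite det_mulmx det_lblock det1 mulr1 det_scalar1.
rewrite mulmx_block !mulmx0 !mulmx1 !mulmxN !add0r (mulmxA A) mul_mx_adj.
rewrite !mul_mx_scalar mul_scalar_mx subrr det_ublock; congr (_ * _).
by rewrite mulmxA det_mx11 !mxE mulr1n mulrC.
Qed.

Lemma adj_diag_block (D : idomainType) p r (A : 'M[D]_p) (B : 'M[D]_r) :
  \det A != 0 -> \det B != 0 ->
  \adj (block_mx A 0 0 B) =
    block_mx (\det B *: \adj A) 0 0 (\det A *: \adj B).
Proof.
move=> dA dB; apply/esym/adj_unique; first by rewrite det_ublock mulf_neq0.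
rewrite mulmx_block !mulmx0 !mul0mx !addr0 !add0r -!scalemxAr !mul_mx_adj.
by rewrite det_ublock !scale_scalar_mx [\det B * _]mulrC -scalar_mx_block.
Qed.

(* char_poly A times b (X - A)^-1 c *)
Definition green (F : fieldType) n (b : 'rV[F]_n) (A : 'M_n) (c : 'cV_n) :
    {poly F} :=
  (map_mx polyC b *m \adj (char_poly_mx A) *m map_mx polyC c) 0 0.

(** The signs of the two borders cancel in the Schur complement. The remaining block is block
    diagonal, so each [green] term is weighted by the characteristic polynomial of the other
    block. *)
Lemma char_poly_bordered (F : fieldType) p r (b1 : 'rV[F]_p) (b2 : 'rV_r)
    (c1 : 'cV_p) (c2 : 'cV_r) (A : 'M_p) (B : 'M_r) :
  char_poly (block_mx (0 : 'M_1) (row_mx b1 b2) (col_mx c1 c2)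
                      (block_mx A 0 0 B)) =
  ('X * char_poly A - green b1 A c1) * char_poly B
    - char_poly A * green b2 B c2.
Proof.
have cA := monic_neq0 (char_poly_monic A).
have cB := monic_neq0 (char_poly_monic B).
have ED : char_poly_mx (block_mx A 0 0 B) =
    block_mx (char_poly_mx A) 0 0 (char_poly_mx B).
  rewrite /char_poly_mx map_block_mx !map_mx0 scalar_mx_block.
  by rewrite opp_block_mx add_block_mx !oppr0 !addr0.
have -> : char_poly (block_mx (0 : 'M_1) (row_mx b1 b2) (col_mx c1 c2)
                      (block_mx A 0 0 B)) =
  \det (block_mx 'X%:M (map_mx polyC (- row_mx b1 b2))
     (map_mx polyC (- col_mx c1 c2)) (char_poly_mx (block_mx A 0 0 B))).
  rewrite /char_poly; congr (\det _).
  rewrite {1}/char_poly_mx map_block_mx scalar_mx_block opp_block_mx.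
  by rewrite add_block_mx map_mx0 oppr0 addr0 !add0r !map_mxN.
rewrite det_bordered; last by rewrite ED det_ublock mulf_neq0.
rewrite !map_mxN mulNmx mulmxN mulNmx opprK ED adj_diag_block //.
rewrite map_row_mx map_col_mx mul_row_block mul_row_col !mulmx0 addr0 add0r.
rewrite det_ublock mxE -!scalemxAr -!scalemxAl !mxE /green.
rewrite -/(char_poly A) -/(char_poly B) !mxE; ring.
Qed.

(** * Parity of exponents for matrices supported on bipartite graphs *)

Definition parity_poly (F : fieldType) (b : bool) (p : {poly F}) :=
  forall j, p`_j != 0 -> odd j = b.

Lemma parity_polyM (F : fieldType) b b' (p q : {poly F}) :
  parity_poly b p -> parity_poly b' q -> parity_poly (b (+) b') (p * q).
Proof.
move=> hp hq j; rewrite coefM => nz.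
have [i /andP[pi qi]] : exists i : 'I_j.+1, (p`_i != 0) && (q`_(j - i) != 0).
  apply/existsP; apply: contraNT nz; rewrite negb_exists => /forallP h.
  apply/eqP; apply: big1 => i _; have := h i.
  rewrite negb_and !negbK => /orP[] /eqP->; by rewrite ?mul0r ?mulr0.
rewrite -(hp _ pi) -(hq _ qi) -oddD subnKC //; exact: (ltn_ord i).
Qed.

Lemma parity_polyB (F : fieldType) b (p q : {poly F}) :
  parity_poly b p -> parity_poly b q -> parity_poly b (p - q).
Proof.
move=> hp hq j; rewrite coefB => nz.
have [p0|] := eqVneq p`_j 0; last exact: hp.
by apply: hq; apply: contraNneq nz => ->; rewrite p0 subr0.
Qed.

Lemma parity_polyX (F : fieldType) : parity_poly true ('X : {poly F}).
Proof. by move=> j; rewrite coefX; case: (j =P 1%N) => [->|] //=; rewrite eqxx. Qed.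

(** A proper 2-coloring of the support graph of [A]; in particular the diagonal vanishes. *)
Definition bicolored (F : fieldType) n (s : 'I_n -> bool) (A : 'M[F]_n) :=
  forall i j, A i j != 0 -> s i != s j.

Lemma coef_compNX (F : fieldType) (p : {poly F}) j :
  (p \Po (- 'X))`_j = (-1) ^+ j * p`_j.
Proof.
elim/poly_ind: p j => [|p c IH] j; first by rewrite comp_poly0 coef0 mulr0.
rewrite comp_polyD comp_polyM comp_polyX comp_polyC mulrN.
rewrite !(coefD, coefN, coefMX, coefC).
case: j => [|j] /=; first by rewrite expr0 mul1r oppr0.
by rewrite !addr0 IH exprS mulN1r mulNr.
Qed.

(* Conjugating X - A by the diagonal sign matrix of s turns it into X + A. *)
Lemma char_poly_bicolored (F : numFieldType) n (s : 'I_n -> bool)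
    (A : 'M[F]_n) :
  bicolored s A -> parity_poly (odd n) (char_poly A).
Proof.
move=> sA.
pose S : 'M[{poly F}]_n := diag_mx (\row_i (-1) ^+ s i).
have SS : S *m S = 1%:M.
  rewrite mulmx_diag; apply/matrixP=> i j; rewrite !mxE.
  by rewrite -expr2 sqrr_sign.
have E : map_mx (comp_poly (- 'X)) (char_poly_mx A) =
    - (S *m char_poly_mx A *m S).
  apply/matrixP=> i j; rewrite mul_diag_mx !mxE (bigD1 j) //= big1 => [|l lj].
    rewrite !mxE rmorphB rmorphMn /= comp_polyX comp_polyC addr0.
    rewrite eqxx mulr1n.
    have [->|ij] := eqVneq i j.
      rewrite !mulr1n mulrAC -expr2 sqrr_sign mul1r.
      have [->|nz] := eqVneq (A j j) 0; first by rewrite polyC0 !subr0.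
      by have := sA _ _ nz; rewrite eqxx.
    rewrite !mulr0n !sub0r.
    have [->|nz] := eqVneq (A i j) 0; first by rewrite polyC0 !(oppr0,mulr0,mul0r).
    have := sA _ _ nz; case: (s i); case: (s j) => //= _.
    - by rewrite expr1 expr0; ring.
    - by rewrite expr1 expr0; ring.
  by rewrite !mxE (negbTE lj) mulr0n mulr0.
have Ed : char_poly A \Po (- 'X) = (-1) ^+ n * char_poly A.
  rewrite /char_poly -det_map_mx E -scaleN1r detZ !det_mulmx.
  by rewrite mulrAC -det_mulmx SS det1 mul1r.
move=> j nz.
have := congr1 (fun p : {poly F} => p`_j) Ed.
rewrite coef_compNX -[_ ^+ n]/(_ ^+ n) -signr_odd -(signr_odd _ n).
have -> : ((-1) ^+ odd n * char_poly A)`_j = (-1) ^+ odd n * (char_poly A)`_j.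
  by case: (odd n); rewrite ?expr0 ?expr1 ?mul1r ?mulN1r ?coefN.
move/(mulIf nz); case: (odd j); case: (odd n) => //=; rewrite expr0 expr1 => /eqP.
  by rewrite eq_sym -subr_eq0 opprK -mulr2n pnatr_eq0.
by rewrite -subr_eq0 opprK -mulr2n pnatr_eq0.
Qed.

(* Comparing coefficients in (X - A) adj(X - A) = char_poly A. *)
Lemma coef_adj_rec (F : fieldType) n (A : 'M[F]_n) i j m :
  (\adj (char_poly_mx A) i j)`_m =
  (char_poly A)`_m.+1 *+ (i == j)
  + \sum_l A i l * (\adj (char_poly_mx A) l j)`_m.+1.
Proof.
have := congr1 (fun M : 'M[{poly F}]_n => (M i j)`_m.+1)
  (mul_mx_adj (char_poly_mx A)).
rewrite mulmxBl mul_scalar_mx !mxE coefB mulrC coefMX /= coef_sum.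
rewrite coefMn => /eqP; rewrite subr_eq => /eqP ->; congr (_ + _).
by apply: eq_bigr => l _; rewrite mxE coefCM.
Qed.

(** Descending induction on the coefficient index: beyond the largest size [d] of an entry all
    coefficients are 0, and [coef_adj_rec] goes from index [m.+1] down to [m]. *)
Lemma adj_char_poly_mx_ind (F : fieldType) n (A : 'M[F]_n)
    (P : nat -> 'I_n -> 'I_n -> F -> Prop) :
  (forall m i j, P m i j 0) ->
  (forall m i j (f : 'I_n -> F), (forall l, P m.+1 l j (f l)) ->
     P m i j ((char_poly A)`_m.+1 *+ (i == j) + \sum_l A i l * f l)) ->
  forall m i j, P m i j (\adj (char_poly_mx A) i j)`_m.
Proof.
move=> P0 PS m i j.
pose d := \max_(l < n) \max_(l' < n) size (\adj (char_poly_mx A) l l').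
elim: {m}(d - m)%N {-2}m (leqnn (d - m)) i j => [|q IH] m hq i j.
  rewrite nth_default ?P0 //; move: hq; rewrite leqn0 subn_eq0; apply: leq_trans.
  apply: leq_trans (leq_bigmax i); exact: (leq_bigmax j).
rewrite coef_adj_rec; apply: PS => l; apply: IH; lia.
Qed.

Lemma size_adj_char_poly_mx (F : fieldType) n (A : 'M[F]_n) i j m :
  (n <= m)%N -> (\adj (char_poly_mx A) i j)`_m = 0.
Proof.
move: m i j; apply: (@adj_char_poly_mx_ind _ _ _ (fun m _ _ x => (n <= m)%N -> x = 0)).
  by [].
move=> m i j f IH nm; rewrite nth_default ?size_char_poly // mul0rn add0r.
by apply: big1 => l _; rewrite IH ?mulr0 // ltnW.
Qed.

(** In the recurrence at the top index the sum vanishes and only the leading coefficient 1 of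
    [char_poly A] survives. *)
Lemma lead_adj_char_poly_mx (F : fieldType) n (A : 'M[F]_n.+1) i j :
  (\adj (char_poly_mx A) i j)`_n = (i == j)%:R.
Proof.
rewrite coef_adj_rec big1 => [|l _]; last by rewrite size_adj_char_poly_mx ?mulr0.
have := monicP (char_poly_monic A); rewrite /lead_coef size_char_poly => ->.
by rewrite addr0.
Qed.

(** Each step of the recurrence shifts the index by one and follows an edge, so the parity of the
    index and the color of the row vertex flip together. *)
Lemma adj_bicolored (F : numFieldType) n (s : 'I_n -> bool) (A : 'M[F]_n) i j :
  bicolored s A ->
  parity_poly (~~ odd n (+) (s i != s j)) (\adj (char_poly_mx A) i j).
Proof.
move=> sA m; move: m i j.
apply: (@adj_char_poly_mx_ind _ _ _
  (fun m i j x => x != 0 -> odd m = ~~ odd n (+) (s i != s j))).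
  by move=> m i j; rewrite eqxx.
move=> m i j f IH nz.
have [c0|] := eqVneq ((char_poly A)`_m.+1 *+ (i == j)) 0; last first.
  have [->|_] := eqVneq i j; last by rewrite mulr0n eqxx.
  rewrite mulr1n => /(char_poly_bicolored sA) /= <-.
  by rewrite eqxx negbK addbF.
move: nz; rewrite c0 add0r => nz.
have [l /[!mulf_eq0]] : exists l, A i l * f l != 0.
  apply/existsP; apply: contraNT nz; rewrite negb_exists => /forallP h.
  by apply/eqP; apply: big1 => l _; apply/eqP; rewrite -[_ == _]negbK h.
rewrite negb_or => /andP[/sA ail /IH /=].
by move: ail; case: (s i); case: (s j); case: (s l); case: (odd m); case: (odd n).
Qed.

Lemma green_delta (F : fieldType) n (A : 'M[F]_n) i j :
  green (delta_mx 0 i) A (delta_mx j 0) = \adj (char_poly_mx A) i j.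
Proof. by rewrite /green !map_delta_mx -rowE -colE !mxE. Qed.

Lemma greenDl (F : fieldType) n b b' (A : 'M[F]_n) c :
  green (b + b') A c = green b A c + green b' A c.
Proof. by rewrite /green map_mxD !mulmxDl mxE. Qed.

Lemma greenDr (F : fieldType) n b (A : 'M[F]_n) c c' :
  green b A (c + c') = green b A c + green b A c'.
Proof. by rewrite /green map_mxD mulmxDr mxE. Qed.

Lemma greenZl (F : fieldType) n a b (A : 'M[F]_n) c :
  green (a *: b) A c = a *: green b A c.
Proof. by rewrite /green map_mxZ -!scalemxAl mxE mul_polyC. Qed.

Lemma greenZr (F : fieldType) n a b (A : 'M[F]_n) c :
  green b A (a *: c) = a *: green b A c.
Proof. by rewrite /green map_mxZ -scalemxAr mxE mul_polyC. Qed.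

(** * Integral polynomials and the path left when the base vertex is removed from the cycle *)

Definition int_poly (p : {poly rat}) := forall j, p`_j \is a Num.int.

Lemma int_polyB p q : int_poly p -> int_poly q -> int_poly (p - q).
Proof. by move=> ip iq j; rewrite coefB rpredB. Qed.

Lemma int_polyM p q : int_poly p -> int_poly q -> int_poly (p * q).
Proof. by move=> ip iq j; rewrite coefM rpred_sum // => i _; rewrite rpredM. Qed.

Lemma int_polyX : int_poly 'X.
Proof. by move=> j; rewrite coefX rpred_nat. Qed.

(** The block of N on a path of vertices of degree 2, where the weight 2/deg is 1. *)
Definition path_mx n : 'M[rat]_n :=
  \matrix_(i, j) ((i.+1 == j) || (j.+1 == i))%:R.

Lemma path_mx_bicolored n : bicolored (fun i : 'I_n => odd i) (path_mx n).
Proof.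
move=> i j; rewrite mxE; case: orP => [[/eqP <-|/eqP <-]|] //=.
- by case: (odd i).
- by case: (odd j).
Qed.

Lemma char_poly_path_int n : int_poly (char_poly (path_mx n)).
Proof.
have -> : path_mx n = map_mx (intr : int -> rat)
    (\matrix_(i, j) ((i.+1 == j) || (j.+1 == i))%:R).
  by apply/matrixP=> i j; rewrite !mxE; case: (_ || _).
rewrite -map_char_poly => j; rewrite coef_map /=.
exact: intr_int.
Qed.

Lemma path_adj_first l :
  \adj (char_poly_mx (path_mx l.+1)) ord0 ord0 = char_poly (path_mx l).
Proof.
rewrite mxE /cofactor expr0 mul1r; congr (\det _).
apply/matrixP=> i j; rewrite !mxE /=.
by rewrite !(inj_eq (@lift_inj _ _)) /bump /= !add1n !eqSS.
Qed.

Lemma path_adj_last l :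
  \adj (char_poly_mx (path_mx l.+1)) ord_max ord_max = char_poly (path_mx l).
Proof.
rewrite mxE /cofactor addnn -signr_odd odd_double expr0 mul1r; congr (\det _).
apply/matrixP=> i j; rewrite !mxE /= !(inj_eq (@lift_inj _ _)) /bump.
by rewrite ![(l <= _)%N]leqNgt !ltn_ord !add0n.
Qed.

(** Without its last row and first column, X minus the path matrix is lower triangular with [l]
    diagonal entries -1; their product cancels the cofactor sign. *)
Lemma path_adj_corner l : odd l ->
  \adj (char_poly_mx (path_mx l.+1)) ord0 ord_max = 1.
Proof.
move=> ol; rewrite mxE /cofactor addn0 det_trig.
  rewrite (eq_bigr (fun=> -1)) => [|i _].
    by rewrite prodr_const card_ord -exprMn mulrNN mulr1 expr1n.
  rewrite !mxE -!val_eqE /= /bump leqNgt ltn_ord add0n add1n eqxx.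
  by rewrite ltn_eqF // mulr0n sub0r.
apply/is_trig_mxP=> i j ij; rewrite !mxE -!val_eqE /= /bump leqNgt ltn_ord.
rewrite add0n add1n eqSS.
have [-> -> ->] : [/\ (i == j.+1 :> nat) = false, (i == j :> nat) = false &
      (j.+2 == i :> nat) = false].
  by split; lia.
by rewrite mulr0n subr0.
Qed.

Lemma path_adj_corner' l : odd l ->
  \adj (char_poly_mx (path_mx l.+1)) ord_max ord0 = 1.
Proof.
move=> ol; rewrite -[RHS](path_adj_corner ol).
rewrite -[in RHS](trmxK (char_poly_mx _)) -trmx_adj [RHS]mxE; congr (\adj _ _ _).
by apply/matrixP=> i j; rewrite !mxE orbC [i == j]eq_sym.
Qed.

(** The border weights are 2/deg u_i = 1 in the row and 2/deg u = 1/2 in the column. The diagonal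
    corners of the adjugate give [char_poly (path_mx l)] twice and the other two corners give 1
    each; these 1s record the walks around the cycle. *)
Lemma green_path l : odd l ->
  green (delta_mx 0 ord0 + delta_mx 0 ord_max) (path_mx l.+1)
    (2^-1 *: (delta_mx ord0 0 + delta_mx ord_max 0)) =
  char_poly (path_mx l) + 1.
Proof.
move=> ol; rewrite greenZr greenDr !greenDl !green_delta.
rewrite path_adj_first path_adj_last path_adj_corner // path_adj_corner' //.
set q := char_poly _.
have -> : q + 1 + (1 + q) = 2 *: (q + 1) by rewrite scaler_nat; ring.
by rewrite scalerA mulVf ?scale1r.
Qed.

Lemma parity_polyD (F : fieldType) b (p q : {poly F}) :
  parity_poly b p -> parity_poly b q -> parity_poly b (p + q).
Proof.
move=> hp hq j; rewrite coefD => nz.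
have [p0|] := eqVneq p`_j 0; last exact: hp.
by apply: hq; apply: contraNneq nz => ->; rewrite p0 addr0.
Qed.

Lemma parity_polyZ (F : fieldType) b a (p : {poly F}) :
  parity_poly b p -> parity_poly b (a *: p).
Proof. by move=> hp j; rewrite coefZ mulf_eq0 negb_or => /andP[_ /hp]. Qed.

(** * The contribution of the hanging forest, and integrality of the sum of inverse degrees *)

Section Hanging.
Variables (r dv dw : nat) (B : 'M[rat]_r.+1) (s : 'I_r.+1 -> bool).
Variables (a b : 'I_r.+1).

(* B describes the forest left when the cycle is removed; a and b are the
   vertices through which it is attached, of degrees dv and dw. *)
Definition green_hanging :=
  green ((2 / dv%:R) *: delta_mx 0 a + (2 / dw%:R) *: delta_mx 0 b) B
    (2^-1 *: (delta_mx a 0 + delta_mx b 0)).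

Let adjB := \adj (char_poly_mx B).

Lemma green_hangingE :
  green_hanging = dv%:R^-1 *: (adjB a a + adjB a b) +
                  dw%:R^-1 *: (adjB b a + adjB b b).
Proof.
rewrite /green_hanging greenZr greenDr !greenDl !greenZl !green_delta -!/adjB.
have half d : 2^-1 * (2 / d%:R) = d%:R^-1 :> rat by rewrite mulrA mulVf ?mul1r.
by rewrite !(scalerDr, scalerA) !half addrACA.
Qed.

Lemma parity_green_hanging :
  bicolored s B -> s a = s b -> parity_poly (odd r) green_hanging.
Proof.
move=> sB sab; rewrite green_hangingE.
have par i j : s i = s j -> parity_poly (odd r) (adjB i j).
  by move=> sij; have := adj_bicolored (i := i) (j := j) sB;
    rewrite sij eqxx addbF negbK.
by apply: parity_polyD; apply: parity_polyZ; apply: parity_polyD; apply: par.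
Qed.

Lemma size_green_hanging : (size green_hanging <= r.+1)%N.
Proof.
rewrite green_hangingE; apply/leq_sizeP => j rj.
by rewrite !(coefD, coefZ) !size_adj_char_poly_mx // !(addr0, mulr0).
Qed.

(** The top coefficient of the adjugate is the identity matrix, so the mixed entries at [a] and [b]
    drop out. *)
Lemma lead_green_hanging :
  a != b -> green_hanging`_r = dv%:R^-1 + dw%:R^-1.
Proof.
move=> ab; rewrite green_hangingE !(coefD, coefZ) !lead_adj_char_poly_mx.
by rewrite !eqxx [b == a]eq_sym (negbTE ab) addr0 add0r !mulr1.
Qed.
End Hanging.

(** The block matrix is N with the vertices ordered as u, the path, the forest; here [l] is k -
    2. *)
Lemma hanging_degrees_integral l r dv dw (B : 'M[rat]_r.+1)
    (s : 'I_r.+1 -> bool) a b :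
  odd l -> bicolored s B -> s a = s b -> a != b ->
  int_poly (char_poly (block_mx (0 : 'M_1)
    (row_mx (delta_mx 0 ord0 + delta_mx 0 ord_max)
       ((2 / dv%:R) *: delta_mx 0 a + (2 / dw%:R) *: delta_mx 0 b))
    (col_mx (2^-1 *: (delta_mx ord0 0 + delta_mx ord_max 0))
       (2^-1 *: (delta_mx a 0 + delta_mx b 0)))
    (block_mx (path_mx l.+1) 0 0 B))) ->
  dv%:R^-1 + dw%:R^-1 \is a @Num.int rat.
Proof.
move=> ol sB sab ab; rewrite char_poly_bordered green_path //.
rewrite -/(green_hanging _ _ _ _ _).
set P := char_poly (path_mx l.+1); set P' := char_poly (path_mx l).
set R := char_poly B; set Q := green_hanging _ _ _ _ _.
have pP : parity_poly false P.
  by have := char_poly_bicolored (@path_mx_bicolored l.+1); rewrite /= ol.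
have pP' : parity_poly true P'.
  by have := char_poly_bicolored (@path_mx_bicolored l); rewrite ol.
have pR : parity_poly (~~ odd r) R := char_poly_bicolored sB.
have pQ : parity_poly (odd r) Q := parity_green_hanging sB sab.
have G1 : parity_poly true ('X * P - P').
  apply: parity_polyB => //; exact: (parity_polyM (@parity_polyX _) pP).
have G2 : parity_poly (odd r) (('X * P - P') * R - P * Q).
  apply: parity_polyB; last exact: (parity_polyM pP pQ).
  by have := parity_polyM G1 pR; rewrite addTb negbK.
(* The term [R] split off here comes from the 1 in [green_path]. Its exponents have the parity
   opposite to that of all the others, so no cancellation with [E] can occur. *)
have -> : ('X * P - (P' + 1)) * R - P * Q = ('X * P - P') * R - P * Q - R by ring.
set E := _ - P * Q in G2 *; move=> ER.
have iR : int_poly R.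
  move=> j; have [->|nz] := eqVneq R`_j 0; first exact: rpred0.
  have := ER j; rewrite coefB; have [->|/G2 oj] := eqVneq E`_j 0.
    by rewrite sub0r rpredN.
  by have := pR _ nz; rewrite oj; case: (odd r).
have iE : int_poly E.
  by move=> j; have := rpredD (ER j) (iR j); rewrite coefB subrK.
have iPQ : int_poly (P * Q).
  have -> : P * Q = ('X * P - P') * R - E by rewrite /E; ring.
  apply: int_polyB iE; apply: int_polyM iR; apply: int_polyB.
    by apply: int_polyM int_polyX _; apply: char_poly_path_int.
  exact: char_poly_path_int.
(* Only a nonzero sum is the true leading coefficient of [Q]. *)
have [Q0|Qn0] := eqVneq (dv%:R^-1 + dw%:R^-1 : rat) 0; first by rewrite Q0 rpred0.
have := lead_green_hanging dv dw B ab; rewrite -/Q => Qr.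
have sQ : size Q = r.+1.
  apply/eqP; rewrite eqn_leq size_green_hanging ltnNge; apply: contra Qn0 => sQ.
  by rewrite -Qr nth_default.
have <- : lead_coef (P * Q) = dv%:R^-1 + dw%:R^-1.
  rewrite lead_coefM (monicP (char_poly_monic _)) mul1r -Qr lead_coefE.
  by rewrite sQ.
exact: iPQ.
Qed.

(** With z the integer sum, d + d' = z d d'. If z = 1 this reads (d - 1)(d' - 1) = 1; if z is at
    least 2, then d + d' <= d d' + 1 forces d d' <= 1. *)
Lemma inv_sum_integral (d d' : nat) :
  (0 < d)%N -> (0 < d')%N -> (d%:R^-1 + d'%:R^-1 : rat) \is a Num.int ->
  (d = 1 /\ d' = 1)%N \/ (d = 2 /\ d' = 2)%N.
Proof.
move=> d0 d'0 /intrP[z Ez].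
have nd : d%:R != 0 :> rat by rewrite pnatr_eq0 -lt0n.
have nd' : d'%:R != 0 :> rat by rewrite pnatr_eq0 -lt0n.
have : (d + d')%:Z = z * d%:Z * d'%:Z.
  apply: (@intr_inj rat); rewrite !rmorphM /= -Ez -!pmulrn natrD.
  by field; rewrite nd nd'.
move=> E.
have z0 : 0 < z by nia.
have [z1|z2] : z = 1 \/ 2%:Z <= z by lia.
  subst z; right; suff: (d - 1)%:Z * (d' - 1)%:Z = 1.
    have [d1|d1] : (d = 1 \/ 2 <= d)%N by lia.
      by subst d; rewrite mul0r.
    have [d1'|d1'] : (d' = 1 \/ 2 <= d')%N by lia.
      by subst d'; rewrite mulr0.
    by nia.
  by nia.
have h1 : (d%:Z - 1) * (d'%:Z - 1) >= 0 by nia.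
have h2 : (z - 2) * (d%:Z * d'%:Z) >= 0 by nia.
have h3 : d%:Z * d'%:Z <= 1 by nia.
by left; nia.
Qed.

End PolyMatrices.

(** * From the spectrum of N to that of the Grover walk *)

Section GroverSpectrum.
Local Open Scope ring_scope.
Variables (T : finType) (e : rel T) (n : nat) (h : 'I_n -> T).
Hypotheses (e_sym : symmetric e) (deg_gt0 : forall x, (0 < deg e x)%N).
Hypothesis h_bij : bijective h.

(* Twice the transposed transition matrix, indexed through h. *)
Definition walk_mx : 'M[rat]_n :=
  \matrix_(i, j) (if e (h i) (h j) then 2 / (deg e (h j))%:R else 0).

(** Right multiplication by these incidence matrices lifts a row vector on vertices to a row vector
    on arcs. *)
Let term_mx : 'M[rat]_(n, #|{: Defs.arc e}|) :=
  \matrix_(i, f) (term (enum_val f) == h i)%:R.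
Let org_mx : 'M[rat]_(n, #|{: Defs.arc e}|) :=
  \matrix_(i, f) (org (enum_val f) == h i)%:R.
Let U := grover_matrix e.

Lemma sum_arc (F : T -> T -> rat) :
  \sum_(f < #|{: Defs.arc e}|) F (org (enum_val f)) (term (enum_val f)) =
  \sum_x \sum_(y | e x y) F x y.
Proof.
rewrite pair_big_dep /= (big_sub [pred p : T * T | e p.1 p.2] (fun p => F p.1 p.2)).
rewrite [RHS](reindex (@enum_val _ {: Defs.arc e})) //.
apply: onW_bij; exact: enum_val_bij.
Qed.

(** Splits U into a scattering part, depending on [b] only through its terminus, minus the arc
    reversal. *)
Lemma grover_entryE (a b : Defs.arc e) :
  grover_entry a b = (if term b == org a then 2 / (deg e (term b))%:R else 0)
    - ((org a == term b) && (org b == term a))%:R.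
Proof.
rewrite /grover_entry [term b == _]eq_sym.
by case: (org a == _); case: (org b == _); rewrite //= ?subr0.
Qed.

(** The scattering part yields [walk_mx]; the reversal exchanges terminus and origin. *)
Lemma term_grover : term_mx *m U = walk_mx *m term_mx - org_mx.
Proof.
apply/matrixP=> i f; rewrite !mxE; set b := enum_val f.
under eq_bigr => g _ do rewrite !mxE grover_entryE -/b mulrBr.
rewrite (sum_arc (fun x y => (y == h i)%:R *
   (if term b == x then 2 / (deg e (term b))%:R else 0) -
   (y == h i)%:R * ((x == term b) && (org b == y))%:R)).
rewrite (bigD1 (term b)) //= [X in _ + X]big1 ?addr0; last first.
  move=> x xb; apply: big1 => y _.
  by rewrite [_ == x]eq_sym (negbTE xb) /= !mulr0 subr0.
rewrite sumrB eqxx /=; congr (_ - _).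
  have [j hj] : exists j, h j = term b.
    by case: h_bij => g _ gK; exists (g (term b)).
  rewrite [RHS](bigD1 j) //= [X in _ = _ + X]big1 ?addr0; last first.
    move=> l lj; rewrite !mxE -/b -hj (inj_eq (bij_inj h_bij)) eq_sym.
    by rewrite (negbTE lj) mulr0.
  rewrite !mxE -/b hj eqxx mulr1 e_sym; case: ifP => [eb|/negbT eb].
    rewrite (bigD1 (h i)) //= eqxx mul1r big1 ?addr0 // => y /andP[_ /negbTE->].
    by rewrite mul0r.
  apply: big1 => y eby; case: eqP => [yh|]; last by rewrite mul0r.
  by rewrite -yh eby in eb.
rewrite (bigD1 (org b)) /=; last by rewrite e_sym; exact: (valP b).
rewrite eqxx mulr1 big1 ?addr0 // => y /andP[_ yb].
by rewrite [org b == y]eq_sym (negbTE yb) mulr0.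
Qed.

(** The arcs leaving the terminus of [b] carry 2/deg each, in total 2, and the reversal takes away
    1. *)
Lemma org_grover : org_mx *m U = term_mx.
Proof.
apply/matrixP=> i f; rewrite !mxE; set b := enum_val f.
under eq_bigr => g _ do rewrite !mxE grover_entryE -/b mulrBr.
rewrite (sum_arc (fun x y => (x == h i)%:R *
   (if term b == x then 2 / (deg e (term b))%:R else 0) -
   (x == h i)%:R * ((x == term b) && (org b == y))%:R)).
rewrite (bigD1 (term b)) //= [X in _ + X]big1 ?addr0; last first.
  move=> x xb; apply: big1 => y _.
  by rewrite [_ == x]eq_sym (negbTE xb) /= !mulr0 subr0.
rewrite sumrB -!mulr_sumr -mulrBr eqxx.
have -> : \sum_(y | e (term b) y) (true && (org b == y))%:R = 1 :> rat.
  rewrite (bigD1 (org b)) /=; last by rewrite e_sym; exact: (valP b).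
  rewrite eqxx big1 ?addr0 // => y /andP[_ yb].
  by rewrite eq_sym (negbTE yb).
rewrite sumr_const.
have -> : #|[pred y | e (term b) y]| = deg e (term b) by rewrite /deg cardsE.
rewrite -[_ *+ deg _ _]mulr_natr divfK ?pnatr_eq0 -?lt0n //.
by rewrite (_ : 2 - 1 = 1) ?mulr1.
Qed.

(** Every vertex is the terminus of some arc, whose column reads off one coordinate of [v]. Hence
    eigenvectors lift to nonzero vectors. *)
Lemma term_mx_free (v : 'rV[algC]_n) : 
  v *m map_mx ratr term_mx = 0 -> v = 0.
Proof.
move=> v0; apply/rowP=> i; rewrite [RHS]mxE.
have [y] : exists y, y \in [set y | e (h i) y] by apply/card_gt0P/deg_gt0.
rewrite inE e_sym => yi.
have := congr1 (fun M : 'rV_ _ => M 0 (enum_rank (Sub (y, h i) yi : Defs.arc e))) v0.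
rewrite !mxE (bigD1 i) //= big1 ?addr0 => [|j ji];
  rewrite !mxE enum_rankK /term SubK /=.
  by rewrite eqxx rmorph1 mulr1.
by rewrite (inj_eq (bij_inj h_bij)) eq_sym (negbTE ji) rmorph0 mulr0.
Qed.

Lemma char_poly_walk_int : grover_periodic e -> int_poly (char_poly walk_mx).
Proof.
case=> m [m0 Um].
pose r := ratr : rat -> algC.
pose V := map_mx r U.
have Vroot (z : 'rV_ _) a : z != 0 -> z *m V = a *: z -> a ^+ m = 1.
  move=> z0 zV.
  have zVj j : z *m map_mx r (U ^+ j) = a ^+ j *: z.
    elim: j => [|j IH]; first by rewrite !expr0 map_mx1 mulmx1 scale1r.
    by rewrite exprS -mulmxE map_mxM mulmxA zV -scalemxAl IH scalerA exprS.
  have := zVj m; rewrite Um map_mx1 mulmx1 => /eqP.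
  rewrite -subr_eq0 -{1}[z]scale1r -scalerBl scaler_eq0 (negbTE z0) orbF.
  by rewrite subr_eq0 => /eqP.
have Aroot a b : a * b = 1 -> a ^+ m = 1 -> a + b \in Aint.
  move=> ab am; have bm : b ^+ m = 1.
    by rewrite -[LHS]mul1r -am -exprMn ab expr1n.
  by apply: rpredD; apply: (Aint_unity_root m0); apply/unity_rootP.
have eigA a : root (char_poly (map_mx r walk_mx)) a -> a \in Aint.
  rewrite -eigenvalue_root_char => /eigenvalueP[v va v0].
  pose z := v *m map_mx r term_mx.
  have z0 : z != 0 by apply: contraNneq v0 => /term_mx_free/eqP.
  (* The lift [z] is annihilated by V^2 - a V + 1. *)
  have zV : z *m V *m V = a *: (z *m V) - z.
    have zV1 : z *m V = a *: z - v *m map_mx r org_mx.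
      rewrite /z /V -mulmxA -map_mxM term_grover map_mxB map_mxM mulmxBr.
      by rewrite mulmxA va scalemxAl.
    rewrite {1}zV1 mulmxBl -scalemxAl; congr (_ - _).
    by rewrite /V -mulmxA -map_mxM org_grover.
  (* [x] and [y] below are the roots of t^2 - a t + 1. *)
  pose q := sqrtC (a ^+ 2 - 4).
  have qq : q ^+ 2 = a ^+ 2 - 4 by rewrite sqrtCK.
  pose x := (a + q) / 2; pose y := (a - q) / 2.
  have xy : x * y = 1.
    have -> : x * y = (a ^+ 2 - q ^+ 2) / 4 by rewrite /x /y; field.
    by rewrite qq; field.
  have axy : a = x + y by rewrite /x /y; field.
  rewrite axy.
  (* Since (V - x)(V - y) kills [z], either [z] is an eigenvector for [x], or [z *m V - x *: z] is
     one for [y]. One root being a root of unity suffices, as the other is its inverse. *)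
  have [w0|wn0] := eqVneq (z *m V - x *: z) 0.
    by apply: Aroot => //; apply: (Vroot z) => //; apply/eqP; rewrite -subr_eq0 w0.
  rewrite addrC; apply: Aroot; first by rewrite mulrC.
  apply: (Vroot _ _ wn0); rewrite mulmxBl zV -scalemxAl scalerBr scalerA.
  by rewrite mulrC xy scale1r axy scalerDl addrAC [x *: _ + _]addrC addrK.
move=> j.
have [rs ch] := closed_field_poly_normal (char_poly (map_mx r walk_mx)).
rewrite (monicP (char_poly_monic _)) scale1r in ch.
have : (char_poly (map_mx r walk_mx))`_j \in Aint.
  have : {in rs, forall a, a \in Aint}.
    by move=> a ars; apply: eigA; rewrite ch root_prod_XsubC.
  rewrite ch; elim: rs j {ch} => [|a rs IH] j ars.
    by rewrite big_nil coef1 rpred_nat.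
  rewrite big_cons mulrBl coefB coefXM coefCM rpredB //.
    case: ifP => _; rewrite ?rpred0 // IH // => b brs.
    by apply: ars; rewrite inE brs orbT.
  apply: rpredM; first by rewrite ars ?mem_head.
  apply: IH => b brs.
  by apply: ars; rewrite inE brs orbT.
rewrite -map_char_poly coef_map /= => A.
(* A rational algebraic integer is an integer. *)
have : ratr (char_poly walk_mx)`_j \is a @Num.int algC.
  by apply: Cint_rat_Aint => //; apply: rpred_rat.
case/intrP=> z zE; apply/intrP; exists z; apply: (fmorph_inj (ratr : rat -> algC)).
exact: etrans zE (esym (ratr_int _ z)).
Qed.

End GroverSpectrum.

(** * Breadth-first trees and a 2-coloring away from the odd cycle *)

Section Coloring.
Variables (T : finType) (e : rel T).

(** [d] is the distance from [r], and [p x] the last vertex but one of a shortest path to [x]: a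
    shorter path to [p x] would extend to a shorter one to [x]. *)
Lemma bfs_parent (r : T) : connected_graph e ->
  exists (d : T -> nat) (p : T -> T),
    forall x, x != r -> e (p x) x /\ d x = (d (p x)).+1.
Proof.
move=> conn.
pose P x n := [exists t : n.-tuple T, path e r t && (last r t == x)].
have exP x : exists n, P x n.
  have /connectP[q eq xq] := conn r x; exists (size q).
  by apply/existsP; exists (in_tuple q); rewrite /= eq xq eqxx.
pose d x := ex_minn (exP x).
have par x : exists y, x != r -> e y x /\ d x = (d y).+1.
  rewrite /d; case: ex_minnP => n /existsP[[q /= /eqP sq] /andP[eq /eqP xq]] min.
  case/lastP: q sq eq xq => [|q z] sq eq xq.
    by exists r; rewrite -xq eqxx.
  rewrite last_rcons in xq; subst z; rewrite rcons_path in eq.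
  case/andP: eq => eq eyx; exists (last r q) => _; split => //.
  rewrite size_rcons in sq; case: ex_minnP => m /existsP[[t /= /eqP st]].
  case/andP=> et /eqP ty miny; rewrite -sq; congr _.+1; apply/eqP.
  rewrite eqn_leq -ltnS sq -st -(size_rcons t x) min /=; last first.
    apply/existsP; exists (in_tuple (rcons t x)).
    by rewrite /= rcons_path et ty eyx last_rcons eqxx.
  rewrite st; apply: miny; apply/existsP; exists (in_tuple q).
  by rewrite /= eq eqxx.
by exists d; apply: fin_all_exists par.
Qed.

(* The n - 1 edges towards BFS parents change the parity of the depth. Only
   one edge is left, and it lies on the odd cycle, which is not 2-colorable. *)
Lemma off_cycle_coloring (k : nat) (c : nat -> T) :
  symmetric e -> irreflexive e -> connected_graph e -> #|edges e| = #|T| ->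
  odd k -> (forall i, (i < k)%N -> e (c i) (c (i.+1 %% k)%N)) ->
  exists s : T -> bool, forall x y, e x y ->
    (forall i, (i < k)%N -> c i != y) -> s x != s y.
Proof.
move=> e_sym e_irr conn card_e ok ec.
have [d [p pP]] := bfs_parent (c 0) conn.
pose s x := odd (d x); exists s.
pose E := [set [set x; p x] | x in [set~ c 0]].
have EP x y : [set x; y] \in E -> s x != s y.
  case/imsetP=> z; rewrite !inE => /pP[_ dz] xyz.
  have szp : s z != s (p z) by rewrite /s dz /=; case: (odd _).
  have /set2P xz : x \in [set z; p z] by rewrite -xyz set21.
  have /set2P yz : y \in [set z; p z] by rewrite -xyz set22.
  have /set2P zx : z \in [set x; y] by rewrite xyz set21.
  have /set2P px : p z \in [set x; y] by rewrite xyz set22.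
  have pzz : p z <> z by move=> E'; rewrite E' eqxx in szp.
  move: px zx; case: xz => ->; case: yz => -> [] // px [] // zx;
    by [rewrite eq_sym | case: pzz].
(* Two vertices with the same parent edge would be parents of each other, against the depths. *)
have cardE : #|E| = #|T|.-1.
  rewrite card_in_imset ?cardsC1 // => x y; rewrite !inE => /pP[_ dx] /pP[_ dy] xy.
  have : x \in [set y; p y] by rewrite -xy !inE eqxx.
  have : y \in [set x; p x] by rewrite xy !inE eqxx.
  rewrite !inE => /orP[/eqP//|/eqP yx] /orP[/eqP//|/eqP xy'].
  by move: dx dy; rewrite -yx -xy'; lia.
have subE : E \subset edges e.
  apply/subsetP=> A /imsetP[x]; rewrite !inE => /pP[exp _] ->.
  by apply/imsetP; exists (x, p x); rewrite // inE /= e_sym.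
have card1 : #|edges e :\: E| = 1.
  rewrite cardsD (setIidPr subE) cardE card_e.
  have : (0 < #|T|)%N by apply/card_gt0P; exists (c 0).
  by lia.
have /cards1P[A0 A0P] : #|edges e :\: E| == 1 by rewrite card1.
have offE x y : e x y -> s x = s y -> [set x; y] = A0.
  move=> exy sxy; apply/set1P; rewrite -A0P !inE; apply/andP; split.
    by apply/negP=> /EP; rewrite sxy eqxx.
  by apply/imsetP; exists (x, y).
(* Otherwise the colors alternate along the cycle, which fails at the closing edge because [k] is
   odd. *)
have [i ik sci] : exists2 i, (i < k)%N & s (c i) = s (c (i.+1 %% k)%N).
  have [/existsP[i /eqP ?]|] :=
    boolP [exists i : 'I_k, s (c i) == s (c (i.+1 %% k)%N)].
    by exists i.
  rewrite negb_exists => /forallP alt.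
  have sc j : (j < k)%N -> s (c j) = s (c 0) (+) odd j.
    elim: j => [|j IH] jk; first by rewrite addbF.
    have := alt (Ordinal (ltnW jk)); rewrite /= modn_small // IH ?(ltnW jk) //.
    by case: (s (c j.+1)); case: (s (c 0)); case: (odd j).
  have k0 : (0 < k)%N by case: (k) ok.
  have km : (k.-1 < k)%N by rewrite prednK.
  have := alt (Ordinal km); rewrite /= prednK // modnn sc //.
  have -> : odd k.-1 = false by move: ok; rewrite -{1}(prednK k0) /= => /negbTE.
  by rewrite addbF eqxx.
move=> x y exy yc; apply/eqP=> /(offE _ _ exy) xyA.
have : y \in [set c i; c (i.+1 %% k)%N].
  by rewrite (offE _ _ (ec i ik) sci) -xyA !inE eqxx orbT.
rewrite !inE => /orP[]/eqP yi; subst y; last first.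
  by have := yc _ (ltn_pmod i.+1 (leq_ltn_trans (leq0n i) ik)); rewrite eqxx.
by have := yc _ ik; rewrite eqxx.
Qed.

End Coloring.

(** * Adjacency in the unicycle graph and the block form of N *)

Section PendantForest.
Local Open Scope ring_scope.
Variables (T : finType) (e : rel T) (l : nat) (c : nat -> T) (v1 w1 : T).
Let k := l.+2.
Hypotheses (unic : odd_unicycle e) (ol : odd l).
Hypothesis (c_inj : forall i j, (i < k)%N -> (j < k)%N -> c i = c j -> i = j).
Hypothesis (ec : forall i, (i < k)%N -> e (c i) (c (i.+1 %% k)%N)).
Hypothesis (deg0 : deg e (c 0%N) = 4%N).
Hypothesis (deg2 : forall i, (0 < i < k)%N -> deg e (c i) = 2%N).
Hypotheses (ev : e (c 0%N) v1) (ew : e (c 0%N) w1) (vw : v1 != w1).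
Hypothesis (vwc : forall i, (i < k)%N -> c i != v1 /\ c i != w1).

Let e_sym : symmetric e. Proof. by case: unic => -[]. Qed.
Let e_irr : irreflexive e. Proof. by case: unic => -[]. Qed.

Lemma path_step i : (i.+1 < k)%N -> e (c i) (c i.+1).
Proof. by move=> ik; have := ec (ltnW ik); rewrite modn_small. Qed.

Lemma closing_step : e (c l.+1) (c 0%N).
Proof. by have := ec (ltnSn l.+1); rewrite modnn. Qed.

(** The two cycle neighbors are distinct and already exhaust the degree 2, so the cycle has no chord
    here. *)
Lemma cycle_inner_nbr i y : (0 < i < k)%N -> e (c i) y ->
  y = c i.-1 \/ y = c (i.+1 %% k)%N.
Proof.
case: i => // i /= ik eiy.
pose A := [set c i; c (i.+2 %% k)%N].
have ik' : (i < k)%N by apply: ltnW.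
have mk : (i.+2 %% k < k)%N by rewrite ltn_pmod.
have cA : #|A| = 2%N.
  rewrite cards2; case: eqP => // /(c_inj ik' mk).
  have [->|ne] := eqVneq i l; first by rewrite modnn; move: ol; case: (l).
  by rewrite modn_small; move: ne ik; rewrite /k; lia.
have sA : A \subset [set y | e (c i.+1) y].
  apply/subsetP=> z; rewrite !inE => /orP[]/eqP->; last exact: ec.
  by rewrite e_sym path_step.
have /eqP EA : A == [set y | e (c i.+1) y].
  by rewrite eqEcard sA cA -/(deg _ _) deg2.
have : y \in A by rewrite EA inE.
by rewrite !inE => /orP[]/eqP; auto.
Qed.

Lemma cycle_base_nbr y : e (c 0%N) y -> [\/ y = c 1%N, y = c l.+1, y = v1 | y = w1].
Proof.
move=> ey; have l0 : (0 < l)%N by move: ol; case: (l).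
pose A := [set c 1%N; c l.+1; v1; w1].
have [h1 h2] := vwc (isT : (1 < k)%N).
have [h3 h4] := vwc (ltnSn l.+1).
have h5 : c 1%N != c l.+1.
  by apply/eqP=> /(c_inj (isT : (1 < k)%N) (ltnSn l.+1)); lia.
have cA : #|A| = 4%N.
  rewrite /A -!setUA !cardsU1 cards1 !inE.
  by rewrite (negbTE h5) (negbTE h1) (negbTE h2) (negbTE h3) (negbTE h4) (negbTE vw).
have sA : A \subset [set y | e (c 0%N) y].
  apply/subsetP=> z; rewrite !inE => /orP[/orP[/orP[]|]|] /eqP-> //.
    exact: path_step.
  by rewrite e_sym closing_step.
have /eqP EA : A == [set y | e (c 0%N) y].
  by rewrite eqEcard sA cA -/(deg _ _) deg0.
have : y \in A by rewrite EA inE.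
by rewrite !inE => /orP[/orP[/orP[]|]|] /eqP ->;
  [constructor 1|constructor 2|constructor 3|constructor 4].
Qed.

Lemma inner_adj i j : (i < l.+1)%N -> (j < l.+1)%N ->
  e (c i.+1) (c j.+1) = (i.+1 == j) || (j.+1 == i).
Proof.
move=> il jl; apply/idP/orP => [|[]/eqP E]; last 2 first.
- by subst j; apply: path_step.
- by subst i; rewrite e_sym; apply: path_step.
case/cycle_inner_nbr; first by rewrite /k; lia.
  by move=> /c_inj E; right; apply/eqP; apply: E; rewrite /k /=; lia.
have [->|ne] := eqVneq i l.
  by rewrite modnn => /c_inj E; have := E (jl : (j.+1 < k)%N) isT.
rewrite modn_small; last by rewrite /k; lia.
by move=> /c_inj E; left; have := E (jl : (j.+1 < k)%N) (_ : (i.+2 < k)%N);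
  rewrite /k; lia.
Qed.

Lemma base_adj j : (j < l.+1)%N -> e (c 0%N) (c j.+1) = (j == 0%N) || (j == l).
Proof.
move=> jl; apply/idP/orP => [|[]/eqP ->]; last 2 first.
- exact: path_step.
- by rewrite e_sym closing_step.
have [h1 h2] := vwc (jl : (j.+1 < k)%N).
case/cycle_base_nbr => [/c_inj E|/c_inj E|E|E].
- by left; have := E (jl : (j.+1 < k)%N) isT; lia.
- by right; have := E (jl : (j.+1 < k)%N) (ltnSn l.+1); lia.
- by rewrite E eqxx in h1.
- by rewrite E eqxx in h2.
Qed.

Let Rest := [set x | [forall i : 'I_k, c i != x]].

Lemma RestP x : reflect (forall i, (i < k)%N -> c i != x) (x \in Rest).
Proof.
rewrite inE; apply: (iffP forallP) => h i; last exact: h.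
by move=> ik; have := h (Ordinal ik).
Qed.

Lemma inner_rest i x : (i < l.+1)%N -> x \in Rest -> e (c i.+1) x = false.
Proof.
move=> il /RestP xR; apply/negP=> /cycle_inner_nbr[]; first by rewrite /k; lia.
  by move=> E; have := xR i; rewrite E eqxx => /(_ (ltnW il)).
by move=> E; have := xR (i.+2 %% k)%N; rewrite E eqxx ltn_pmod // => /(_ isT).
Qed.

Lemma base_rest x : x \in Rest -> e (c 0%N) x = (x == v1) || (x == w1).
Proof.
move=> /RestP xR; apply/idP/orP => [|[]/eqP-> //].
case/cycle_base_nbr => E; auto; last 2 first.
- by left; apply/eqP.
- by right; apply/eqP.
- by have := xR 1%N; rewrite E eqxx => /(_ isT).
- by have := xR l.+1; rewrite E eqxx => /(_ (ltnSn _)).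
Qed.

Lemma degrees_unicycle : grover_periodic e ->
  (deg e v1 = 1 /\ deg e w1 = 1)%N \/ (deg e v1 = 2 /\ deg e w1 = 2)%N.
Proof.
move=> per.
have [_ conn _ card_e] := unic.
have ok : odd k by rewrite /k /= negbK.
have [s sP] := off_cycle_coloring e_sym e_irr conn card_e ok ec.
have vR : v1 \in Rest by apply/RestP => i /vwc[].
have wR : w1 \in Rest by apply/RestP => i /vwc[].
have deg_gt0 x : (0 < deg e x)%N.
  have /connectP[[|y q] /= exq xq] := conn x (c 0%N); first by rewrite -xq deg0.
  by case/andP: exq => exy _; apply/card_gt0P; exists y; rewrite inE.
have [r cardR] : exists r, #|Rest| = r.+1.
  have : (0 < #|Rest|)%N by apply/card_gt0P; exists v1.
  by case: #|_| => // r _; exists r.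
have castP (i : 'I_r.+1) : (i < #|Rest|)%N by rewrite cardR.
pose hR (i : 'I_r.+1) : T := enum_val (Ordinal (castP i)).
have hR_in i : hR i \in Rest by apply: enum_valP.
have hR_inj : injective hR by move=> i j /enum_val_inj[] /val_inj.
have hR_surj x : x \in Rest -> exists i, hR i = x.
  move=> xR; have lt : (enum_rank_in xR x < r.+1)%N by rewrite -cardR.
  exists (Ordinal lt); rewrite -[RHS](enum_rankK_in xR xR).
  by congr enum_val; apply: val_inj.
(* Vertices are listed as u, then u_1, ..., u_(k-1), then the forest, to match the blocks of
   [hanging_degrees_integral]. *)
pose h (i : 'I_(1 + (l.+1 + r.+1))) : T :=
  match split i with
  | inl _ => c 0%N
  | inr i' => match split i' with inl j => c j.+1 | inr j => hR j end
  end.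
have h0 i : h (lshift _ i) = c 0%N.
  by rewrite /h -[lshift _ _]/(unsplit (inl _)) unsplitK.
have h1 j : h (rshift 1 (lshift _ j)) = c j.+1.
  rewrite /h -[rshift 1 _]/(unsplit (inr _)) unsplitK.
  by rewrite -[lshift _ _]/(unsplit (inl _)) unsplitK.
have h2 j : h (rshift 1 (rshift _ j)) = hR j.
  rewrite /h -[rshift 1 _]/(unsplit (inr _)) unsplitK.
  by rewrite -[rshift _ _]/(unsplit (inr _)) unsplitK.
have hR_cycle i j : (i < k)%N -> c i <> hR j.
  by move=> ik E; have /RestP/(_ _ ik) := hR_in j; rewrite E eqxx.
have h_inj : injective h.
  move=> i j; case: (split_ordP i) => i' ->; case: (split_ordP j) => j' ->.
  - by rewrite !ord1.
  - case: (split_ordP j') => j'' ->; rewrite h0 ?h1 ?h2.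
      by move/c_inj => /(_ isT (ltn_ord j'')).
    by move/(hR_cycle 0%N _ isT).
  - case: (split_ordP i') => i'' ->; rewrite h0 ?h1 ?h2.
      by move/esym/c_inj => /(_ isT (ltn_ord i'')).
    by move/esym/(hR_cycle 0%N _ isT).
  - case: (split_ordP i') => i'' ->; case: (split_ordP j') => j'' ->.
    + rewrite !h1 => /c_inj => /(_ (ltn_ord i'') (ltn_ord j'')) [E].
      by congr (rshift _ (lshift _ _)); apply: val_inj.
    + by rewrite h1 h2 => /(hR_cycle i''.+1 _ (ltn_ord i'')).
    + by rewrite h1 h2 => /esym/(hR_cycle j''.+1 _ (ltn_ord j'')).
    + by rewrite !h2 => /hR_inj ->.
have h_bij : bijective h.
  apply: inj_card_bij h_inj _; apply: leq_trans (leq_image_card h predT).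
  apply/subset_leq_card/subsetP=> x _.
  have [/hR_surj[i <-]|] := boolP (x \in Rest).
    by rewrite -h2; apply: codom_f.
  rewrite inE negb_forall => /existsP[[[|i] ik] /negPn/eqP /= <-].
    by rewrite -(h0 ord0); apply: codom_f.
  by rewrite -[c _](h1 (Ordinal (ik : (i < l.+1)%N))); apply: codom_f.
have [a ha] := hR_surj _ vR; have [b hb] := hR_surj _ wR.
have ab : a != b by apply: contraNneq vw => E; rewrite -ha -hb E.
(* [hR] reaches only the forest, but the weights still use degrees in the whole graph. *)
pose B : 'M[rat]_r.+1 := walk_mx e hR.
have sB : bicolored (fun i => s (hR i)) B.
  move=> i j; rewrite mxE; case: ifP => [eij _|]; last by rewrite eqxx.
  by apply: sP eij _; apply/RestP.
(* Both attaching vertices have the color opposite to that of u. *)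
have sab : s (hR a) = s (hR b).
  have := sP _ _ ev (RestP _ vR); have := sP _ _ ew (RestP _ wR).
  by rewrite ha hb; case: (s v1); case: (s w1); case: (s _).
apply: inv_sum_integral => //.
apply: (hanging_degrees_integral ol sB sab ab).
have := char_poly_walk_int e_sym deg_gt0 h_bij per.
congr (int_poly (char_poly _)).
rewrite -[LHS](@submxK _ 1 (l.+1 + r.+1) 1 (l.+1 + r.+1)).
have deg1 (j : 'I_l.+1) : deg e (c j.+1) = 2%N by apply: deg2; exact: (ltn_ord j).
(* The two ends of the path are distinct because [l] is odd, so at most one indicator is 1. *)
have ends (j : 'I_l.+1) (x : rat) :
    (if (j == 0 :> nat)%N || (j == l :> nat) then x else 0) =
    x * ((j == ord0)%:R + (j == ord_max)%:R).
  rewrite -!val_eqE /=; have [->|_] := eqVneq (j : nat) 0%N.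
    by move: ol; case: (l) => //= *; rewrite addr0 mulr1.
  by case: eqP => _; rewrite /= add0r ?mulr1 ?mulr0.
have hR_v i : (hR i == v1) = (i == a) by rewrite -ha (inj_eq hR_inj).
have hR_w i : (hR i == w1) = (i == b) by rewrite -hb (inj_eq hR_inj).
have half : 2 / 4 = 2^-1 :> rat by [].
congr block_mx.
- by apply/matrixP=> i j; rewrite !mxE !h0 e_irr.
- rewrite -[LHS](@hsubmxK _ 1 l.+1 r.+1); congr row_mx; apply/matrixP=> i j.
    by rewrite !mxE h0 h1 base_adj // deg1 divff // ends ord1 eqxx mul1r.
  rewrite !mxE h0 h2 base_rest // hR_v hR_w ord1 eqxx /=.
  have [->|ja] := eqVneq j a; first by rewrite ha (negbTE ab) mulr1 mulr0 addr0.
  by have [->|jb] := eqVneq j b; rewrite ?hb ?mulr1 ?mulr0 ?add0r.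
- rewrite -[LHS](@vsubmxK _ l.+1 r.+1 1); congr col_mx; apply/matrixP=> i j.
    by rewrite !mxE h0 h1 e_sym base_adj // deg0 ends ord1 eqxx !andbT half.
  rewrite !mxE h0 h2 e_sym base_rest // deg0 hR_v hR_w ord1 eqxx !andbT half.
  have [->|ia] := eqVneq i a; first by rewrite (negbTE ab) addr0 mulr1.
  by case: eqP; rewrite /= add0r ?mulr1 ?mulr0.
rewrite -[LHS](@submxK _ l.+1 r.+1 l.+1 r.+1); congr block_mx; apply/matrixP=> i j.
- by rewrite !mxE !h1 inner_adj // deg1 divff //; case: ifP.
- by rewrite !mxE h1 h2 inner_rest.
- by rewrite !mxE h1 h2 e_sym inner_rest.
- by rewrite !mxE !h2.
Qed.

End PendantForest.

Theorem theorem3p4 (T : finType) (e : rel T) (k : nat) (c : nat -> T)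
    (v1 w1 : T) :
  odd_unicycle e ->
  (3 <= k)%N -> odd k ->
  (forall i j, (i < k)%N -> (j < k)%N -> c i = c j -> i = j) ->
  (forall i, (i < k)%N -> e (c i) (c (i.+1 %% k)%N)) ->
  deg e (c 0%N) = 4 ->
  (forall i, (0 < i < k)%N -> deg e (c i) = 2) ->
  e (c 0%N) v1 -> e (c 0%N) w1 -> v1 != w1 ->
  (forall i, (i < k)%N -> c i != v1 /\ c i != w1) ->
  grover_periodic e ->
  (deg e v1 = 1 /\ deg e w1 = 1) \/ (deg e v1 = 2 /\ deg e w1 = 2).
Proof.
case: k => [|[|l]] // unic _ ok c_inj ec deg0 deg2 ev ew vw vwc per.
have ol : odd l by move: ok; rewrite /= negbK.
exact: (degrees_unicycle unic ol c_inj ec deg0 deg2 ev ew vw vwc per).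
Qed.
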